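(* Let $\gamma:I\to M^3$ be a PA curve with $(\mathcal V,\theta)$ in a connected orientable Riemannian $3$-manifold, with curvature $\kappa$ and torsion $\tau$, where $\mathcal V$ is a concircular vector field along $\gamma$ with potential function $f$, not parallel along $\gamma$, and $\cos\theta\neq0$. Then the ratio $\tau/\kappa$ of its torsion to curvature is a nonzero constant $r_0\in\mathbb R$ if and only if $$\theta(s)=\sin^{-1}\left(r_0\int^s f(u)\,du+r_1\right),\qquad r_1\in\mathbb R.$$ In particular, if in this case $f$ is a nonzero constant $f_0$, then, up to an integration constant, $$\kappa(s)=\pm\frac{f_0}{\sqrt{1-(r_0f_0s)^2}},\qquad \tau(s)=r_0\,\kappa(s),\qquad -\frac{1}{|r_0f_0|}<s<\frac{1}{|r_0f_0|}.$$
   Context: $\nabla$ is the Levi-Civita connection, $I\subset\mathbb R$ is an interval, $s\in I$ is arc length, $\int^s f(u)\,du$ denotes an antiderivative of $f$, and $r_1$ is a constant. Frenet curve in $M^3$: a smooth curve with $\gamma',\nabla_{\gamma'}\gamma',\nabla_{\gamma'}^2\gamma'$ linearly independent along $I$. When parametrized by arc length it has a positively oriented orthonormal Frenet frame $\{T=\gamma',N,B\}$ and curvatures $\kappa=\kappa_1>0$, $\tau=\kappa_2>0$ with $\nabla_TT=\kappa N$, $\nabla_TN=-\kappa T+\tau B$, $\nabla_TB=-\tau N$. Concircular along $\gamma$: a vector field $\mathcal V$ along $\gamma$ is concircular along $\gamma$ with potential function $f:I\to\mathbb R$ (smooth) if $\nabla_T\mathcal V=fT$. Parallel along $\gamma$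 means $\nabla_T\mathcal V=0$ identically. PA (prescribed angle) curve: an arc length parametrized Frenet curve $\gamma$ is a PA curve with $(\mathcal V,\theta)$, where $\mathcal V$ is a nowhere zero vector field along $\gamma$ and $\theta:I\to[0,\pi]$ is smooth, if $\mathcal V$ has unit length along $\gamma$ and $\theta$ is the angle between $\mathcal V$ and the principal normal $N$, i.e. $\cos\theta=\langle\mathcal V,N\rangle$.
   Formalization: The formula for θ is corrected: r_0 is replaced by ε r_0, where ε = ±1 is the constant sign with ⟨V,B⟩ = ε sin θ (the printed formula fails for ε = −1), and sin^{-1} means one fixed branch along I, arcsin or π − arcsin, since cos θ may be negative. *)

(* Defs.v *)
From HB Require Import structures.
From mathcomp Require Import all_boot all_order all_algebra.
From mathcomp Require Import ring.
From mathcomp Require Import all_classical all_reals all_analysis.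
Set Implicit Arguments.
Unset Strict Implicit.
Unset Printing Implicit Defensive.
Import Order.TTheory GRing.Theory Num.Theory.
Import numFieldNormedType.Exports.
Local Open Scope classical_set_scope.
Local Open Scope ring_scope.

(* In finite dimension, differentiability together with C^k directional
   derivatives in all directions is the usual C^k.+1 condition on open sets. *)
Fixpoint Ck (R : realType) (V W : normedModType R) (k : nat) (U : set V)
    (f : V -> W) : Prop :=
  if k is k'.+1 then
    (forall x, U x -> differentiable f x) /\
    (forall v, Ck k' U (fun x => 'D_v f x))
  else forall x, U x -> {for x, continuous f}.

(* On a set that is not open (e.g. an interval with endpoints), smooth means
   smooth on some open neighbourhood of the set. *)
Definition smooth_on (R : realType) (V W : normedModType R) (A : set V)
    (f : V -> W) : Prop :=
  exists U : set V, [/\ open U, A `<=` U & forall k, Ck k U f].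

Definition nondegenerate_interval (R : realType) (I : set R) : Prop :=
  is_interval I /\ exists a b, [/\ I a, I b & a < b].

Definition is_antiderivative (R : realType) (I : set R) (f F : R -> R) : Prop :=
  forall s, I s -> is_derive s 1 F (f s).

(* Since sine is not injective on [0, pi], the inverse sine has there two
   branches, asin and pi - asin; theta follows one of them along I.
   The library's asin is only meaningful on [-1, 1]. *)
Definition is_inverse_sine (R : realType) (I : set R) (theta x : R -> R) : Prop :=
  (forall s, I s -> -1 <= x s <= 1) /\
  ((forall s, I s -> theta s = asin (x s)) \/
   (forall s, I s -> theta s = pi - asin (x s))).

(* A smooth atlas; chart_map c is a homeomorphism from chart_dom c onto its
   image, with inverse chart_inv c (the values elsewhere are irrelevant). *)
Record smooth_atlas (R : realType) (n : nat) (M : topologicalType) := SmoothAtlas {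
  chart : Type ;
  chart_dom : chart -> set M ;
  chart_map : chart -> M -> 'rV[R]_n ;
  chart_inv : chart -> 'rV[R]_n -> M ;
  chart_at : M -> chart ;
  chart_atP : forall p, chart_dom (chart_at p) p ;
  chart_dom_open : forall c, open (chart_dom c) ;
  chart_img_open : forall c, open (chart_map c @` chart_dom c) ;
  chart_mapK : forall c p, chart_dom c p -> chart_inv c (chart_map c p) = p ;
  chart_map_continuous : forall c p, chart_dom c p ->
    {for p, continuous (chart_map c)} ;
  chart_inv_continuous : forall c p, chart_dom c p ->
    {for chart_map c p, continuous (chart_inv c)} ;
  chart_transition_smooth : forall c d,
    smooth_on (chart_map c @` (chart_dom c `&` chart_dom d))
              (chart_map d \o chart_inv c)
}.

Section Riemannian.
Context (R : realType) (n : nat) (M : topologicalType) (A : smooth_atlas R n M).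

Definition transition (c d : chart A) : 'rV[R]_n -> 'rV[R]_n :=
  chart_map d \o chart_inv c.

Definition chart_img (c : chart A) : set 'rV[R]_n :=
  chart_map c @` chart_dom c.

(* o c p = 1 when the chart c is positively oriented at p, and -1 otherwise. *)
Definition is_orientation (o : chart A -> M -> R) : Prop :=
  (forall c p, chart_dom c p ->
     (o c p = 1 \/ o c p = -1) /\ \forall q \near p, o c q = o c p) /\
  (forall c d p, chart_dom c p -> chart_dom d p ->
     o d p = Num.sg (\det (jacobian (transition c d) (chart_map c p))) * o c p).

Record riemannian_metric := RiemannianMetric {
  metric : chart A -> 'rV[R]_n -> 'M[R]_n ;
  metric_smooth : forall c i j, smooth_on (chart_img c) (fun x => metric c x i j) ;
  metric_sym : forall c x, chart_img c x -> (metric c x)^T = metric c x ;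
  metric_pos : forall c x (v : 'rV[R]_n), chart_img c x -> v != 0 ->
    0 < (v *m metric c x *m v^T) 0 0 ;
  metric_transition : forall c d p, chart_dom c p -> chart_dom d p ->
    let J := jacobian (transition c d) (chart_map c p) in
    metric c (chart_map c p) = J *m metric d (chart_map d p) *m J^T
}.

(* A tangent vector at p is given by its components in every chart around p,
   related by the differentials of the transition maps. *)
Definition tvec := chart A -> 'rV[R]_n.

Definition is_tangent (p : M) (v : tvec) : Prop :=
  forall c d, chart_dom c p -> chart_dom d p ->
    v d = 'd (transition c d) (chart_map c p) (v c).

(* Components in charts that do not contain p are irrelevant. *)
Definition eq_at (p : M) (v w : tvec) : Prop :=
  forall c, chart_dom c p -> v c = w c.

Definition tscale (a : R) (v : tvec) : tvec := fun c => a *: v c.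

Definition tzero : tvec := fun=> 0.

Context (g : riemannian_metric).

Definition inner (p : M) (v w : tvec) : R :=
  let c := chart_at A p in (v c *m metric g c (chart_map c p) *m (w c)^T) 0 0.

(* Christoffel symbols Gamma^k_ij of the Levi-Civita connection; they are
   characterized by christoffel_torsion_free and christoffel_compatible. *)
Definition christoffel (c : chart A) (x : 'rV[R]_n) (k i j : 'I_n) : R :=
  let dg l a b := 'D_(delta_mx 0 l) (fun y => metric g c y a b) x in
  2^-1 * \sum_l invmx (metric g c x) k l * (dg i j l + dg j i l - dg l i j).

Context (gamma : R -> M).

Definition smooth_curve (I : set R) : Prop :=
  exists U : set R, [/\ open U, I `<=` U,
    forall s, U s -> {for s, continuous gamma} &
    forall c : chart A, smooth_on (U `&` gamma @^-1` chart_dom c) (chart_map c \o gamma)].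

Definition smooth_field (I : set R) (V : R -> tvec) : Prop :=
  exists U : set R, [/\ open U, I `<=` U,
    forall s, U s -> is_tangent (gamma s) (V s) &
    forall c : chart A, smooth_on (U `&` gamma @^-1` chart_dom c) (fun s => V s c)].

Definition velocity (s : R) : tvec := fun c => derive1 (chart_map c \o gamma) s.

(* Covariant derivative along gamma: the components of V' + Gamma(gamma', V). *)
Definition covD (V : R -> tvec) (s : R) : tvec := fun c =>
  derive1 (fun t => V t c) s +
  \row_k \sum_i \sum_j christoffel c (chart_map c (gamma s)) k i j
                       * velocity s c 0 i * V s c 0 j.

Definition unit_speed (I : set R) : Prop :=
  forall s, I s -> inner (gamma s) (velocity s) (velocity s) = 1.

Definition concircular_along (I : set R) (V : R -> tvec) (f : R -> R) : Prop :=
  smooth_on I f /\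
  forall s, I s -> eq_at (gamma s) (covD V s) (tscale (f s) (velocity s)).

Definition parallel_along (I : set R) (V : R -> tvec) : Prop :=
  forall s, I s -> eq_at (gamma s) (covD V s) tzero.

End Riemannian.

Section LeviCivita.
Context (R : realType) (n : nat) (M : topologicalType) (A : smooth_atlas R n M).
Context (g : riemannian_metric A) (c : chart A) (x : 'rV[R]_n).
Context (cx : chart_img c x).

Let metric_symE i j : metric g c x i j = metric g c x j i.
Proof. by rewrite -[in LHS](metric_sym g cx) mxE. Qed.

Let dmetric_sym l a b :
  'D_(delta_mx 0 l) (fun y => metric g c y a b) x =
  'D_(delta_mx 0 l) (fun y => metric g c y b a) x.
Proof.
apply: near_eq_derive.
have xc : nbhs x (chart_img c) by apply: open_nbhs_nbhs; split=> //; exact: chart_img_open.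
by near=> y; rewrite -[in LHS](metric_sym g (near xc y _)) ?mxE.
Unshelve. all: by end_near. Qed.

Let metric_unit : metric g c x \in unitmx.
Proof.
rewrite -row_free_unit -kermx_eq0; apply/eqP/row_matrixP => i.
rewrite row0; apply/eqP/negPn/negP => vN0.
have := metric_pos g cx vN0.
have /sub_kermxP -> : (row i (kermx (metric g c x)) <= kermx (metric g c x))%MS
  by exact: row_sub.
by rewrite mul0mx mxE ltxx.
Qed.

Lemma christoffel_torsion_free k i j :
  christoffel g c x k i j = christoffel g c x k j i.
Proof.
rewrite /christoffel; congr (_ * _); apply: eq_bigr => l _; congr (_ * _).
by rewrite (dmetric_sym l i j) [X in X - _]addrC.
Qed.

Let lower i j l : \sum_k metric g c x l k * christoffel g c x k i j =
  2^-1 * ('D_(delta_mx 0 i) (fun y => metric g c y j l) x +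
          'D_(delta_mx 0 j) (fun y => metric g c y i l) x -
          'D_(delta_mx 0 l) (fun y => metric g c y i j) x).
Proof.
pose D := \col_l ('D_(delta_mx 0 i) (fun y => metric g c y j l) x +
          'D_(delta_mx 0 j) (fun y => metric g c y i l) x -
          'D_(delta_mx 0 l) (fun y => metric g c y i j) x).
have : metric g c x *m (invmx (metric g c x) *m D) = D by rewrite mulKVmx.
move=> /matrixP /(_ l 0); rewrite [in X in _ = X -> _]mxE => <-.
rewrite mxE mulr_sumr; apply: eq_bigr => k _.
rewrite /christoffel mulrCA; congr (_ * (_ * _)).
by rewrite mxE; apply: eq_bigr => m _; rewrite mxE.
Qed.

Lemma christoffel_compatible i j l :
  'D_(delta_mx 0 i) (fun y => metric g c y j l) x =
  \sum_k (christoffel g c x k i j * metric g c x k l +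
          christoffel g c x k i l * metric g c x j k).
Proof.
rewrite big_split /=.
under eq_bigr do rewrite mulrC metric_symE.
rewrite lower.
under eq_bigr do rewrite mulrC.
rewrite lower -mulrDr (dmetric_sym i l j).
by field.
Qed.

End LeviCivita.

Section Curves.
Context (R : realType) (M : topologicalType) (A : smooth_atlas R 3 M).
Context (g : riemannian_metric A) (o : chart A -> M -> R).
Context (I : set R) (gamma : R -> M).

Let T : R -> tvec A := velocity gamma.

(* A Frenet curve parametrized by arc length. *)
Record frenet_curve : Prop := FrenetCurve {
  frenet_smooth : smooth_curve A gamma I ;
  frenet_unit_speed : unit_speed g gamma I ;
  frenet_independent : forall s c, I s -> chart_dom c (gamma s) ->
    free [:: T s c; covD g gamma T s c; covD g gamma (covD g gamma T) s c]
}.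

(* (velocity, N, B) is the Frenet frame, with curvature kappa and torsion tau. *)
Record frenet_apparatus (N B : R -> tvec A) (kappa tau : R -> R) : Prop :=
  FrenetApparatus {
  frenet_smoothN : smooth_field gamma I N ;
  frenet_smoothB : smooth_field gamma I B ;
  frenet_smooth_kappa : smooth_on I kappa ;
  frenet_smooth_tau : smooth_on I tau ;
  frenet_kappa_gt0 : forall s, I s -> 0 < kappa s ;
  frenet_tau_gt0 : forall s, I s -> 0 < tau s ;
  frenet_orthonormal : forall s, I s ->
    let ip := inner g (gamma s) in
    [/\ ip (T s) (T s) = 1, ip (N s) (N s) = 1 & ip (B s) (B s) = 1] /\
    [/\ ip (T s) (N s) = 0, ip (T s) (B s) = 0 & ip (N s) (B s) = 0] ;
  frenet_positive : forall s c, I s -> chart_dom c (gamma s) ->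
    0 < o c (gamma s) *
        \det (\matrix_(i < 3) nth 0 [:: T s c; N s c; B s c] i) ;
  frenet_T : forall s, I s ->
    eq_at (gamma s) (covD g gamma T s) (fun c => kappa s *: N s c) ;
  frenet_N : forall s, I s ->
    eq_at (gamma s) (covD g gamma N s)
      (fun c => - kappa s *: T s c + tau s *: B s c) ;
  frenet_B : forall s, I s ->
    eq_at (gamma s) (covD g gamma B s) (fun c => - tau s *: N s c)
}.

(* The condition that a curve with Frenet apparatus (N, B, kappa, tau) is a PA
   (prescribed angle) curve with (V, theta). *)
Record PA_curve (N B : R -> tvec A) (kappa tau : R -> R)
    (V : R -> tvec A) (theta : R -> R) : Prop := PACurve {
  PA_frenet : frenet_curve ;
  PA_apparatus : frenet_apparatus N B kappa tau ;
  PA_smooth : smooth_field gamma I V ;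
  PA_neq0 : forall s, I s -> ~ eq_at (gamma s) (V s) (@tzero R 3 M A) ;
  PA_unit : forall s, I s -> inner g (gamma s) (V s) (V s) = 1 ;
  PA_smooth_angle : smooth_on I theta ;
  PA_angle_range : forall s, I s -> 0 <= theta s <= pi ;
  PA_angle : forall s, I s -> cos (theta s) = inner g (gamma s) (V s) (N s)
}.

End Curves.

(* Main.v *)
Require Import Defs.
From HB Require Import structures.
From mathcomp Require Import all_boot all_order all_algebra.
From mathcomp Require Import ring lra.
From mathcomp Require Import all_classical all_reals all_analysis.
Import Order.TTheory GRing.Theory Num.Theory.
Import numFieldNormedType.Exports.
Local Open Scope classical_set_scope.
Local Open Scope ring_scope.
Set Implicit Arguments.
Unset Strict Implicit.
Unset Printing Implicit Defensive.

(** The idea. Write a, b = cos theta and c for the components of V along the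
    Frenet frame (T, N, B). Since the connection is metric, the Frenet
    equations and the concircularity of V turn into the linear system
<<
      a' = f + kappa b,    b' = - kappa a + tau c,    c' = - tau b,
>>
    and V being a unit field means a^2 + b^2 + c^2 = 1. Everything after that
    is one-variable calculus on I.

    Differentiating the constraint gives f a = 0. Near a point where f does
    not vanish, a vanishes identically, so a' = 0 there and f = - kappa b.
    As b never vanishes, the continuous function f / (kappa b) takes only the
    values 0 and -1 on the interval I; V is not parallel, so -1 is attained and
    f = - kappa b on all of I (potentialE). Hence a = 0 and V lies in the normal
    plane (tangential_eq0).

    Now c^2 = (sin theta)^2, and c = eps sin theta with a single sign eps
    (binormal_sign): at an interior zero of c the function sin theta = |c| has a
    minimum, hence derivative 0, which forces c' = - tau b to vanish there.

    Finally c' = - tau b = (tau / kappa) f, so tau / kappa is the constant r0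
    exactly when c is r0 times an antiderivative of f, up to a constant
    (ratio_constantP); as cos theta keeps its sign, theta stays in one of the
    two halves of [0, pi], on which sine is inverted by asin or by pi - asin
    (is_inverse_sineP). When f is constant, c is affine in s, and
    kappa = - f / b with b^2 = 1 - c^2
    (curvature_of_constant_potential). *)

(** * Derivatives on an interval *)

Lemma is_derive_continuous (R : realType) (u : R -> R) (s d : R) :
  is_derive s 1 u d -> {for s, continuous u}.
Proof. by case=> du _; exact/differentiable_continuous/derivable1_diffP. Qed.

Lemma is_derive_cvg (R : realType) (u : R -> R) (s d : R) : is_derive s 1 u d ->
  h^-1 * (u (h + s) - u s) @[h --> 0^'] --> d.
Proof.
case=> /(@cvg_ex _ _)[l ul] <-; rewrite (_ : 'D_1 u s = l); last exact: cvg_lim.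
have -> : (fun h => h^-1 * (u (h + s) - u s)) =
    (fun h => h^-1 *: ((u \o shift s) (h *: 1) - u s)); last exact: ul.
by apply/funext => h; rewrite /= [h *: 1]mulr1.
Qed.

(** Where a function touches 0 from above it has a critical point, but the
    absolute value of a function that crosses 0 transversally has a corner: the
    difference quotients of u and v have the same absolute values. *)
Lemma is_derive_eq0_of_norm (R : realType) (u v : R -> R) (z dv : R) :
  u z = 0 -> (\forall t \near z, u t = `|v t|) ->
  is_derive z 1 u 0 -> is_derive z 1 v dv -> dv = 0.
Proof.
move=> uz uv /is_derive_cvg du /is_derive_cvg /cvg_norm dv'.
have vz : v z = 0 by apply/eqP; rewrite -normr_eq0 -(nbhs_singleton uv) uz.
move/cvg_norm : du; rewrite normr0 => du.
apply/eqP; rewrite -normr_eq0; apply/eqP.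
apply: (cvg_unique _ dv'); first exact: norm_hausdorff.
apply: cvg_trans du; apply: near_eq_cvg; rewrite near_withinE.
have uv0 : \forall h \near 0, u (h + z) = `|v (h + z)|.
  by move: uv; rewrite (near_shift 0) /= subr0.
apply: filterS uv0 => h uvh _.
by rewrite !normrM uz vz !subr0 uvh normr_id.
Qed.

Section Interval.
Context (R : realType) (I : set R).
Hypothesis ndI : nondegenerate_interval I.

(** The derivatives here are two-sided also at the endpoints of I, where the
    functions are only related to each other on one side; that side already
    determines the derivative, because a nondegenerate interval contains points
    arbitrarily close to s and different from it. *)
Lemma is_derive_unique_on (u v : R -> R) (s du dv : R) :
  I s -> (\forall t \near s, I t -> u t = v t) ->
  is_derive s 1 u du -> is_derive s 1 v dv -> du = dv.
Proof.
move=> Is uv udu vdv.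
have [itvI [a [b [Ia Ib ab]]]] := ndI.
have [t It ts] : exists2 t, I t & t != s.
  by have [->|] := eqVneq s a; [exists b; rewrite ?gt_eqF|exists a; rewrite // eq_sym].
have seg h : 0 <= h <= 1 -> I (s + h * (t - s)).
  move=> /andP[h0 h1]; have [st|st] := leP s t.
    by apply: (itvI s t) => //; apply/andP; split; nra.
  by apply: (itvI t s) => //; apply/andP; split; nra.
apply/eqP; rewrite -subr_eq0; apply/negPn/negP => dN0.
have dw : is_derive s 1 (u - v) (du - dv) by exact: is_deriveB.
have := is_derive_cvg dw.
move/cvgrPdist_lt => /(_ `|du - dv|); rewrite normr_gt0 => /(_ dN0).
rewrite near_withinE => /nbhs_ballP[e /= e0 He].
move/nbhs_ballP : uv => [r /= r0 Hr].
(* the step k (t - s) stays in I, as k <= 1, and is shorter than e and r *)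
pose m := Num.min e r.
have m0 : 0 < m by rewrite lt_min e0.
have nt : 0 < `|t - s| by rewrite normr_gt0 subr_eq0.
pose k := Num.min 1 (m / 2 / `|t - s|).
have k0 : 0 < k by rewrite lt_min ltr01 !divr_gt0.
have km : k * `|t - s| < m.
  apply: (@le_lt_trans _ _ (m / 2)); last lra.
  by rewrite -ler_pdivlMr // ge_min lexx orbT.
have kI : I (s + k * (t - s)) by apply: seg; rewrite ltW //= ge_min lexx.
have hn : `|k * (t - s)| < m by rewrite normrM (gtr0_norm k0).
have uvs : u s = v s by apply: Hr => //; rewrite /ball /= subrr normr0.
have := He (k * (t - s)); rewrite /ball /= sub0r normrN.
have -> : `|k * (t - s)| < e by apply: (lt_le_trans hn); rewrite ge_min lexx.
move=> /(_ isT); rewrite mulf_neq0 ?subr_eq0 ?(gt_eqF k0) // => /(_ isT).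
rewrite (addrC _ s) !fctE (Hr (s + k * (t - s))) //; last first.
  rewrite /ball /= opprD addNKr normrN.
  by apply: (lt_le_trans hn); rewrite ge_min lexx orbT.
by rewrite uvs !subrr mulr0 subr0 ltxx.
Qed.

(** The intermediate point is recorded to lie strictly between two points of I:
    this makes it interior, which a minimum argument requires. *)
Lemma IVT_on (u : R -> R) (s t v : R) : I s -> I t ->
  (forall x, I x -> {for x, continuous u}) -> u s < v < u t ->
  exists x, [/\ I x, u x = v & exists y z, [/\ I y, I z & y < x < z]].
Proof.
move=> Is It cu /andP[sv vt]; have [itvI _] := ndI.
have main x y : I x -> I y -> x <= y -> Num.min (u x) (u y) <= v <= Num.max (u x) (u y) ->
    u x != v -> u y != v ->
  exists x, [/\ I x, u x = v & exists y z, [/\ I y, I z & y < x < z]].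
  move=> Ix Iy xy mm xv yv.
  have sub z : z \in `[x, y] -> I z.
    by move=> zxy; apply: (itvI x y) => //; rewrite inE/= in_itv /= in zxy.
  have [|z zxy uz] := @IVT _ u x y v xy _ mm.
    by apply: continuous_in_subspaceT => z; rewrite inE => zxy; apply: cu; apply: sub; rewrite inE.
  exists z; split; [by apply: sub; rewrite inE|exact uz|exists x, y; split => //].
  move: zxy; rewrite /= in_itv /= => /andP[xz zy].
  rewrite !lt_neqAle xz zy !andbT; apply/andP; split; apply/eqP => E.
    by rewrite E uz eqxx in xv.
  by rewrite -E uz eqxx in yv.
have [st|/ltW ts] := leP s t.
  apply: (main s t) => //; rewrite ?(lt_eqF sv) ?(gt_eqF vt) //.
  by rewrite ge_min le_max (ltW sv) (ltW vt) orbT.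
apply: (main t s) => //; rewrite ?(lt_eqF sv) ?(gt_eqF vt) //.
by rewrite ge_min le_max (ltW sv) (ltW vt) orbT.
Qed.

Lemma constant_sign_on (u : R -> R) :
  (forall x, I x -> {for x, continuous u}) -> (forall x, I x -> u x != 0) ->
  (forall x, I x -> 0 < u x) \/ (forall x, I x -> u x < 0).
Proof.
move=> cu uN0.
have [[s [Is us]]|H] := pselect (exists s, I s /\ u s < 0); last first.
  left=> x Ix; rewrite lt_neqAle eq_sym uN0 //= leNgt; apply/negP => ux.
  by apply: H; exists x.
right=> t It; rewrite lt_neqAle uN0 //= leNgt; apply/negP => ut.
have [|x [Ix /eqP ux _]] := IVT_on Is It cu (v := 0); first by rewrite us.
by move: ux; apply/negP; exact: uN0.
Qed.

Lemma constant_on (u : R -> R) :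
  (forall s, I s -> is_derive s 1 u 0) -> exists k, forall s, I s -> u s = k.
Proof.
have [itvI [a [_ [Ia _ _]]]] := ndI => du.
exists (u a).
have main x y : I x -> I y -> x <= y -> u y = u x.
  move=> Ix Iy xy.
  have sub z : z \in `[x, y] -> I z.
    by move=> zxy; apply: (itvI x y) => //; rewrite in_itv /= in zxy.
  have [||z zxy /eqP] := @MVT_segment _ u (fun=> 0) x y xy.
  - by move=> z zxy; apply: du; apply: sub; exact: subset_itv_oo_cc.
  - apply: derivable_within_continuous => z zxy.
    by case: (du z (sub _ zxy)).
  by rewrite mul0r subr_eq0 => /eqP.
move=> s Is; have [as_|/ltW sa] := leP a s; first exact: main.
exact/esym/main.
Qed.

End Interval.

(** As cos theta has a constant sign, theta stays on one side of pi / 2, which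
    selects one of the two branches of the inverse sine along all of I. *)
Lemma is_inverse_sineP (R : realType) (I : set R) (theta x : R -> R) :
  nondegenerate_interval I ->
  (forall s, I s -> 0 <= theta s <= pi) ->
  (forall s, I s -> cos (theta s) != 0) ->
  (forall s, I s -> {for s, continuous (cos \o theta)}) ->
  is_inverse_sine I theta x <-> (forall s, I s -> sin (theta s) = x s).
Proof.
move=> ndI range cN0 cc; split=> [[xb [E|E]] s Is|E].
- by rewrite E // asinK // in_itv /= xb.
- by rewrite E // sinB sinpi cospi mul0r sub0r mulN1r opprK asinK // in_itv /= xb.
have pi2 : pi / 2 \in `[0, pi :> R].
  by rewrite in_itv /=; have := pi_gt0 R; move=> ?; apply/andP; split; lra.
split=> [s Is|]; first by rewrite -E // sin_geN1 sin_le1.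
have [cp|cn] := constant_sign_on ndI cc cN0; [left|right] => s Is.
  have := cp s Is; rewrite /= -cos_pihalf ltr_cos ?in_itv ?range // => th.
  have /andP[t0 tpi] := range s Is; have pi0 := pi_gt0 R.
  by rewrite -E // sinK // in_itv /=; apply/andP; split; lra.
have := cn s Is; rewrite /= -cos_pihalf ltr_cos ?in_itv ?range // => th.
have -> : x s = sin (pi - theta s).
  by rewrite -E // sinB sinpi cospi mul0r sub0r mulN1r opprK.
rewrite sinK; first by rewrite opprB addrC subrK.
have /andP[t0 tpi] := range s Is; have pi0 := pi_gt0 R.
by rewrite in_itv /=; apply/andP; split; lra.
Qed.

(** * The components of a concircular unit field in the Frenet frame *)

Section ScalarFrenet.
Context (R : realType) (I : set R).
(* a, b and c stand for the components of V along T, N and B. *)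
Context (a b c f kappa tau : R -> R).
Hypothesis ndI : nondegenerate_interval I.
Hypothesis da : forall s, I s -> is_derive s 1 a (f s + kappa s * b s).
Hypothesis db : forall s, I s -> is_derive s 1 b (- kappa s * a s + tau s * c s).
Hypothesis dc : forall s, I s -> is_derive s 1 c (- tau s * b s).
Hypothesis unit : forall s, I s -> a s ^+ 2 + b s ^+ 2 + c s ^+ 2 = 1.
Hypothesis kappa_gt0 : forall s, I s -> 0 < kappa s.
Hypothesis tau_gt0 : forall s, I s -> 0 < tau s.
Hypothesis b_neq0 : forall s, I s -> b s != 0.
Hypothesis cf : forall s, I s -> {for s, continuous f}.
Hypothesis ckappa : forall s, I s -> {for s, continuous kappa}.

(** This is the derivative of the constraint a^2 + b^2 + c^2 = 1: the rotation
    terms of the Frenet system cancel, only the potential contributes. *)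
Lemma potential_mul_tangential s : I s -> f s * a s = 0.
Proof.
move=> Is.
have := is_derive_unique_on ndI Is (u := a ^+ 2 + b ^+ 2 + c ^+ 2) (v := cst 1).
have ha := da Is; have hb := db Is; have hc := dc Is.
move=> /(_ _ _ _ (is_deriveD (is_deriveD (is_deriveX 2 ha) (is_deriveX 2 hb)) (is_deriveX 2 hc))
   (is_derive_cst _ _ _)).
have H : \forall t \near s, I t -> (a ^+ 2 + b ^+ 2 + c ^+ 2) t = cst 1 t.
  near=> t => It; rewrite /= -(unit It).
  by rewrite !fctE.
move=> /(_ H); rewrite /= !expr1 /GRing.scale /= => E.
by nra.
Unshelve. all: by end_near. Qed.

(** The potential, being continuous, is nonzero around s. *)
Lemma tangential_eq0_near s : I s -> f s != 0 -> \forall t \near s, I t -> a t = 0.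
Proof.
move=> Is fs.
have : \forall t \near s, f t != 0 by exact: (cvgr_neq0 (f s) (cf Is) fs).
apply: filterS => t ft It; have /eqP := potential_mul_tangential It.
by rewrite mulf_eq0 (negPf ft) => /eqP.
Qed.

(** Since a vanishes around s, so does its derivative f + kappa b. *)
Lemma potential_dichotomy s : I s -> f s != 0 -> f s = - kappa s * b s.
Proof.
move=> Is fs.
have := is_derive_unique_on ndI Is (tangential_eq0_near Is fs) (da Is) (is_derive_cst (0 : R) _ _).
by lra.
Qed.

(** The function q = f / (kappa b) is continuous with values in {0, -1} by the
    previous lemma, hence constant on I. *)
Lemma potentialE : (exists2 s, I s & f s != 0) ->
  forall s, I s -> f s = - kappa s * b s.
Proof.
move=> [s0 Is0 f0] s Is; have [fs|] := eqVneq (f s) 0; last exact: potential_dichotomy.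
pose q t := f t / (kappa t * b t).
have D t : I t -> kappa t * b t != 0.
  by move=> It; apply: mulf_neq0; [rewrite gt_eqF // kappa_gt0|exact: b_neq0].
have cq x : I x -> {for x, continuous q}.
  move=> Ix; apply: continuousM; first exact: cf.
  apply: continuousV; first exact: D.
  apply: continuousM; first exact: ckappa.
  exact: is_derive_continuous (db Ix).
have qE t : I t -> f t != 0 -> q t = -1.
  by move=> It ft; rewrite /q potential_dichotomy // mulNr mulNr divff ?D.
have [|x [Ix qx _]] := IVT_on ndI Is0 Is cq (v := - 2^-1).
  by rewrite (qE _ Is0) // /q fs mul0r; apply/andP; split; lra.
have [fx|fx] := eqVneq (f x) 0.
  by move: qx; rewrite /q fx mul0r; lra.
by move: qx; rewrite qE //; lra.
Qed.

Lemma tangential_eq0 : (exists2 s, I s & f s != 0) -> forall s, I s -> a s = 0.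
Proof.
move=> H s Is; have /eqP := potential_mul_tangential Is.
rewrite mulf_eq0 potentialE // mulf_eq0 oppr_eq0 gt_eqF ?kappa_gt0 //= (negPf (b_neq0 Is)) /=.
by move/eqP.
Qed.

(** In the application u is sin theta. The component c can only change sign
    through a zero in the interior of I, where u = |c| would have a minimum
    although c' = - tau b is nonzero. *)
Lemma binormal_sign (u : R -> R) :
  (forall s, I s -> derivable u s 1) -> (forall s, I s -> 0 <= u s) ->
  (forall s, I s -> u s ^+ 2 = c s ^+ 2) ->
  exists eps : R, (eps = 1 \/ eps = -1) /\ forall s, I s -> c s = eps * u s.
Proof.
move=> du u0 uc.
have uE s : I s -> u s = `|c s|.
  by move=> Is; rewrite -sqrtr_sqr -uc // sqrtr_sqr ger0_norm ?u0.
have cN0 y z p : I y -> I z -> y < p < z -> c p != 0.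
  move=> Iy Iz ypz; apply/eqP => cp.
  have sub t : t \in `]y, z[ -> I t.
    by rewrite in_itv /= => /andP[yt tz]; apply: (ndI.1 y z); rewrite // !ltW.
  have pyz : p \in `]y, z[ by rewrite in_itv.
  have Ip := sub _ pyz.
  have up : u p = 0 by rewrite uE // cp normr0.
  have dup : is_derive p 1 u 0.
    apply: (@derive1_at_min _ _ y z) => // [||t /sub It].
    - by case/andP: ypz => yp pz; exact: ltW (lt_trans yp pz).
    - by move=> t /sub; exact: du.
    - by rewrite up u0.
  have nearE : \forall t \near p, u t = `|c t|.
    by have := near_in_itvoo pyz; apply: filterS => t /sub; exact: uE.
  have /eqP := is_derive_eq0_of_norm up nearE dup (dc Ip).
  by rewrite mulf_eq0 oppr_eq0 gt_eqF ?tau_gt0 //= (negPf (b_neq0 Ip)).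
have cc s : I s -> {for s, continuous c} by move=> /dc; exact: is_derive_continuous.
have [[s [Is cs]]|H] := pselect (exists s, I s /\ c s < 0).
  exists (-1); split; [by right|move=> t It].
  rewrite uE // mulN1r ler0_norm ?opprK // leNgt; apply/negP => ct.
  have [|x [Ix cx [y [z [Iy Iz yxz]]]]] := IVT_on ndI Is It cc (v := 0).
    by rewrite cs.
  by move/eqP: cx; apply/negP; exact: cN0 yxz.
exists 1; split; [by left|move=> t It].
by rewrite mul1r uE // ger0_norm // leNgt; apply/negP => ct; apply: H; exists t.
Qed.

Hypothesis fE : forall s, I s -> f s = - kappa s * b s.

(** From f = - kappa b one gets c' = - tau b = (tau / kappa) f, so both sides
    say that c' = r0 f. *)
Lemma ratio_constantP (r0 : R) (F : R -> R) : is_antiderivative I f F ->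
  (forall s, I s -> tau s / kappa s = r0) <->
  (exists r, forall s, I s -> c s = r0 * F s + r).
Proof.
move=> dF; split=> [H|[r H] s Is].
  have [s Is|r Hr] := constant_on ndI (u := c - r0 \*: F).
    have dcs := dc Is; have dFs := dF s Is.
    apply: is_derive_eq; rewrite fE // -(H s Is) /GRing.scale /=.
    by field; rewrite gt_eqF ?kappa_gt0.
  by exists r => s Is; have <- : c s - r0 * F s = r := Hr s Is; ring.
have dFs := dF s Is.
have := is_derive_unique_on ndI Is (u := c) (v := r0 \*: F + cst r).
move=> /(_ _ _ _ (dc Is) (is_deriveD (is_deriveZ _ dFs) (is_derive_cst _ _ _))).
have nE : \forall t \near s, I t -> c t = (r0 \*: F + cst r) t.
  by near=> t => It; rewrite H // !fctE.
move=> /(_ nE); rewrite fE // addr0 /GRing.scale /= mulrA => /(mulIf (b_neq0 Is)).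
rewrite mulrN => /oppr_inj ->; by rewrite mulfK // gt_eqF ?kappa_gt0.
Unshelve. all: by end_near. Qed.

(** Here c is affine with slope r0 f0, so c = r0 f0 (s + s0); then
    b^2 = 1 - c^2 is positive, which gives the bound on s + s0, and
    kappa = - f0 / b, where b has a constant sign. *)
Lemma curvature_of_constant_potential (r0 f0 : R) :
  (forall s, I s -> a s = 0) -> r0 != 0 -> f0 != 0 ->
  (forall s, I s -> tau s / kappa s = r0) -> (forall s, I s -> f s = f0) ->
  exists s0 sigma : R, (sigma = 1 \/ sigma = -1) /\
    forall s, I s ->
      [/\ - (1 / `|r0 * f0|) < s + s0 < 1 / `|r0 * f0|,
          kappa s =
            sigma * (f0 / Num.sqrt (1 - (r0 * f0 * (s + s0)) ^+ 2)) &
          tau s = r0 * kappa s].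
Proof.
move=> a0 r0N f0N H ff0.
have rf0 : r0 * f0 != 0 by rewrite mulf_neq0.
have dF : is_antiderivative I f (f0 \*: id).
  by move=> s Is; apply: is_derive_eq; rewrite ff0 // /GRing.scale /= mulr1.
have [r Hr] := (ratio_constantP r0 dF).1 H.
(* shifting the parameter by s0 absorbs the integration constant r *)
pose s0 := r / (r0 * f0).
have cE s : I s -> c s = r0 * f0 * (s + s0).
  move=> Is; transitivity (r0 * (f0 * s) + r); [exact: Hr|rewrite /s0; field].
  by apply/andP.
have b2 s : I s -> b s ^+ 2 = 1 - (r0 * f0 * (s + s0)) ^+ 2.
  by move=> Is; rewrite -cE // -(unit Is) a0 //; ring.
have tauE s : I s -> tau s = r0 * kappa s.
  by move=> Is; rewrite -(H s Is) divfK // gt_eqF ?kappa_gt0.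
have bound s : I s -> - (1 / `|r0 * f0|) < s + s0 < 1 / `|r0 * f0|.
  move=> Is; rewrite -ltr_norml ltr_pdivlMr ?normr_gt0 // -normrM mulrC.
  rewrite -(@ltr_pXn2r _ 2) ?nnegrE // expr1n real_normK ?num_real //.
  by rewrite -subr_gt0 -b2 // exprn_even_gt0 //= b_neq0.
have kE s : I s -> kappa s = - (f0 / b s).
  by move=> Is; rewrite -(ff0 s Is) fE //; field; exact: b_neq0.
have cb s : I s -> {for s, continuous b} by move=> /db; exact: is_derive_continuous.
have [bp|bn] := constant_sign_on ndI cb b_neq0.
- exists s0, (-1); split; [by right|move=> s Is; split; [exact: bound| |exact: tauE]].
  by rewrite mulN1r kE // -b2 // sqrtr_sqr gtr0_norm ?bp.
- exists s0, 1; split; [by left|move=> s Is; split; [exact: bound| |exact: tauE]].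
  by rewrite mul1r kE // -b2 // sqrtr_sqr ltr0_norm ?bn // invrN mulrN.
Qed.

End ScalarFrenet.

(** * Differentiation of smooth curves of matrices *)

Lemma smooth_on_differentiable (R : realType) (V W : normedModType R)
    (A : set V) (f : V -> W) x : smooth_on A f -> A x -> differentiable f x.
Proof. by move=> [U [_ AU /(_ 1%N)[+ _]]] Ax; apply; exact: AU. Qed.

Lemma smooth_on_derive1 (R : realType) (W : normedModType R)
    (A : set R) (f : R -> W) : smooth_on A f -> smooth_on A (derive1 f).
Proof.
move=> [U [oU AU CU]]; exists U; split => // k.
rewrite (_ : derive1 f = (fun x => 'D_1 f x)); first exact: (CU k.+1).2 1.
by apply/funext => x; rewrite derive1E.
Qed.

Lemma is_derive_mulmx (R : realType) (m n p : nat) (s : R)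
    (X : R -> 'M[R]_(m, n)) (Y : R -> 'M[R]_(n, p))
    (dX : 'M[R]_(m, n)) (dY : 'M[R]_(n, p)) :
  (forall i j, is_derive s 1 (fun t => X t i j) (dX i j)) ->
  (forall i j, is_derive s 1 (fun t => Y t i j) (dY i j)) ->
  forall i j, is_derive s 1 (fun t => (X t *m Y t) i j)
                            ((dX *m Y s + X s *m dY) i j).
Proof.
move=> hX hY i j.
have -> : (fun t => (X t *m Y t) i j) =
    \sum_k ((fun t => X t i k) * (fun t => Y t k j)).
  by apply/funext => t; rewrite mxE fct_sumE.
apply: is_derive_eq; rewrite !mxE -big_split; apply: eq_bigr => k _ /=.
by rewrite /GRing.scale /= addrC [_ * dX _ _]mulrC.
Qed.

Lemma is_derive_coord (R : realType) (n : nat) (X : R -> 'rV[R]_n) (s : R) i j :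
  differentiable X s -> is_derive s 1 (fun t => X t i j) (derive1 X s i j).
Proof.
move=> dX; have dX1 : derivable X s 1 by exact: diff_derivable.
rewrite derive1E derive_mx // mxE; apply: derivableP.
exact: (derivable_mxP _ _ _).1.
Qed.

Lemma derive1_comp_diff (R : realType) (V W : normedModType R)
    (f : R -> V) (h : V -> W) s : differentiable f s -> differentiable h (f s) ->
  derive1 (h \o f) s = 'd h (f s) (derive1 f s).
Proof.
move=> df dh; rewrite (derive1E' df) derive1E'; last exact: differentiable_comp.
by rewrite (diff_comp df dh).
Qed.

Lemma near_eq_derive1 (R : realType) (V : normedModType R) (f h : R -> V) s :
  (\forall t \near s, f t = h t) -> derive1 f s = derive1 h s.
Proof. by move=> fh; rewrite !derive1E; exact: near_eq_derive. Qed.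

(** * The metric connection along a curve *)

Section Riemannian.
Context (R : realType) (n : nat) (M : topologicalType) (A : smooth_atlas R n M).
Context (g : riemannian_metric A).

(** The inner product is defined in the preferred chart at p, which varies with
    p in an uncontrolled way; to differentiate it along a curve one has to be
    able to compute it in a fixed chart. *)
Lemma inner_chart (c : chart A) p v w : chart_dom c p ->
  is_tangent p v -> is_tangent p w ->
  inner g p v w = (v c *m metric g c (chart_map c p) *m (w c)^T) 0 0.
Proof.
move=> cp tv tw; rewrite /inner.
set d := chart_at A p; have dp : chart_dom d p by exact: chart_atP.
rewrite (tv _ _ cp dp) (tw _ _ cp dp) (metric_transition g cp dp).
rewrite -!(mul_rV_lin1 ('d _ _)) -/(jacobian _ _).
by rewrite trmx_mul !mulmxA.
Qed.

Lemma eq_at_inner p v v' w w' : eq_at p v v' -> eq_at p w w' ->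
  inner g p v w = inner g p v' w'.
Proof. by move=> hv hw; rewrite /inner hv ?hw //; exact: chart_atP. Qed.

Lemma inner_sym p v w : inner g p v w = inner g p w v.
Proof.
rewrite /inner; set c := chart_at A p; pose G := metric g c (chart_map c p).
rewrite -/G; have GT : G^T = G.
  have cx : chart_img c (chart_map c p) by exists p => //; exact: chart_atP.
  exact: (Defs.metric_sym g cx).
have -> : v c *m G *m (w c)^T = (w c *m G *m (v c)^T)^T.
  by rewrite !trmx_mul trmxK GT mulmxA.
by rewrite mxE.
Qed.

Lemma inner_scalel p a v w : inner g p (tscale a v) w = a * inner g p v w.
Proof. by rewrite /inner /tscale -!scalemxAl mxE. Qed.

Lemma inner_scaler p a v w : inner g p v (tscale a w) = a * inner g p v w.
Proof. by rewrite inner_sym inner_scalel inner_sym. Qed.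

Lemma inner_combr p a b v w w' :
  inner g p v (fun c => a *: w c + b *: w' c) =
  a * inner g p v w + b * inner g p v w'.
Proof.
rewrite -!inner_scaler /inner /tscale.
by rewrite [(_ + _)^T]raddfD /= mulmxDr mxE.
Qed.

(** Put the frame as rows of a matrix E. Orthonormality is E G E^T = 1, so
    (G E^T) E = 1 as well, that is, the row v G E^T of inner products with the
    frame is the coordinate vector of v. *)
Lemma inner_parseval p (e : 'I_n -> tvec A) v :
  (forall i j, inner g p (e i) (e j) = (i == j)%:R) ->
  inner g p v v = \sum_i inner g p v (e i) ^+ 2.
Proof.
move=> orth; pose c := chart_at A p; pose G := metric g c (chart_map c p).
pose E : 'M[R]_n := \matrix_i e i c.
have rowE i : row i E = e i c by rewrite rowK.
have EGE : E *m G *m E^T = 1%:M.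
  apply/matrixP => i j; rewrite [RHS]mxE -orth /inner -/c -/G -!rowE.
  rewrite -row_mul [LHS]mxE [RHS]mxE.
  by apply: eq_bigr => k _; rewrite !mxE.
have GEE : G *m E^T *m E = 1%:M by apply: mulmx1C; rewrite mulmxA.
have vE : v c = (v c *m G *m E^T) *m E by rewrite -!mulmxA [G *m _]mulmxA GEE mulmx1.
rewrite {1}/inner -/c -/G {2}vE trmx_mul mulmxA [LHS]mxE.
apply: eq_bigr => i _; rewrite [_^T _ _]mxE -expr2 /inner -/c -/G -rowE.
congr (_ ^+ 2); rewrite [LHS]mxE [RHS]mxE.
by apply: eq_bigr => k _; rewrite !mxE.
Qed.

Context (I : set R) (gamma : R -> M) (smg : smooth_curve A gamma I).

Lemma smooth_field_velocity : smooth_field gamma I (velocity gamma : R -> tvec A).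
Proof.
have [U [oU IU cU smU]] := smg; exists U; split => //; last first.
  by move=> c; exact: smooth_on_derive1.
move=> s Us c d cs ds.
have dc : differentiable (chart_map c \o gamma) s by apply: smooth_on_differentiable (smU c) _.
have dd : differentiable (transition c d) (chart_map c (gamma s)).
  apply: smooth_on_differentiable (chart_transition_smooth c d) _.
  by exists (gamma s).
have nearc : \forall t \near s, chart_dom c (gamma t).
  by apply: cU => //; apply: open_nbhs_nbhs; split => //; exact: chart_dom_open.
rewrite /velocity -[RHS](derive1_comp_diff dc dd).
apply: near_eq_derive1; apply: filterS nearc => t ct.
by rewrite /= /transition /= chart_mapK.
Qed.

(** The matrix of the connection form evaluated on the velocity, acting on row
    vectors from the right. *)
Definition connection_mx (c : chart A) (s : R) : 'M[R]_n :=
  \matrix_(j, k) \sum_i christoffel g c (chart_map c (gamma s)) k i j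
                        * velocity gamma s c 0 i.

Lemma covDE X s c :
  covD g gamma X s c = derive1 (fun t => X t c) s + X s c *m connection_mx c s.
Proof.
congr (_ + _); apply/rowP => k; rewrite !mxE exchange_big; apply: eq_bigr => j _.
by rewrite mxE mulr_sumr; apply: eq_bigr => i _; rewrite mulrC.
Qed.

(** Compatibility of the connection with the metric, contracted with the
    velocity of the curve. *)
Lemma is_derive_metric s c i j : I s -> chart_dom c (gamma s) ->
  is_derive s 1 (fun t => metric g c (chart_map c (gamma t)) i j)
    ((connection_mx c s *m metric g c (chart_map c (gamma s))
      + metric g c (chart_map c (gamma s)) *m (connection_mx c s)^T) i j).
Proof.
move=> Is cs; have [U [oU IU cU smU]] := smg.
set x := chart_map c (gamma s).
have cx : chart_img c x by exists (gamma s).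
have dx : differentiable (chart_map c \o gamma) s.
  by apply: smooth_on_differentiable (smU c) _; split => //; exact: IU.
have dg : differentiable (fun y => metric g c y i j) x.
  exact: smooth_on_differentiable (metric_smooth g c i j) _.
have dgx := differentiable_comp dx dg.
apply: DeriveDef; first exact: ((derivable1_diffP _ _).2 dgx).
rewrite -derive1E [LHS](derive1_comp_diff dx dg) -/(velocity gamma s c).
rewrite {1}(row_sum_delta (velocity gamma s c)).
rewrite raddf_sum /=.
under eq_bigr => l _ do rewrite linearZ /= -(deriveE _ dg) (christoffel_compatible g cx).
rewrite !mxE -big_split /=.
under eq_bigr => l _ do rewrite [_ *: _]mulr_sumr.
rewrite exchange_big; apply: eq_bigr => k _ /=.
rewrite !mxE mulr_suml mulr_sumr -big_split; apply: eq_bigr => l _ /=.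
by rewrite -/x; ring.
Qed.

(** The product rule in one fixed chart: the terms of covD that involve the
    connection matrix add up to the derivative of the metric coefficients. *)
Lemma is_derive_inner X Y s : smooth_field gamma I X -> smooth_field gamma I Y ->
  I s ->
  is_derive s 1 (fun t => inner g (gamma t) (X t) (Y t))
    (inner g (gamma s) (covD g gamma X s) (Y s) +
     inner g (gamma s) (X s) (covD g gamma Y s)).
Proof.
move=> [UX [oX IX tX sX]] [UY [oY IY tY sY]] Is; have [U [oU IU cU smU]] := smg.
pose c := chart_at A (gamma s).
have cs : chart_dom c (gamma s) by exact: chart_atP.
pose G t := metric g c (chart_map c (gamma t)).
pose S := connection_mx c s.
have nearE : \forall t \near s, (X t c *m G t *m (Y t c)^T) 0 0 = inner g (gamma t) (X t) (Y t).
  have nc : \forall t \near s, chart_dom c (gamma t).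
    apply: (cU s (IU _ Is)); apply: open_nbhs_nbhs; split => //; exact: chart_dom_open.
  have nX : \forall t \near s, UX t by apply: open_nbhs_nbhs; split => //; exact: IX.
  have nY : \forall t \near s, UY t by apply: open_nbhs_nbhs; split => //; exact: IY.
  near=> t; apply/esym/inner_chart; [by near: t|apply: tX|apply: tY]; by near: t.
apply: near_eq_is_derive nearE _.
have dX : differentiable (fun t => X t c) s.
  by apply: smooth_on_differentiable (sX c) _; split => //; exact: IX.
have dY : differentiable (fun t => Y t c) s.
  by apply: smooth_on_differentiable (sY c) _; split => //; exact: IY.
have dXG i j : is_derive s 1 (fun t => (X t c *m G t) i j)
    ((derive1 (fun t => X t c) s *m G s
      + X s c *m (S *m G s + G s *m S^T)) i j).
  apply: is_derive_mulmx => {}i {}j; first exact: is_derive_coord.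
  exact: is_derive_metric.
have dYT i j : is_derive s 1 (fun t => (Y t c)^T i j)
    ((derive1 (fun t => Y t c) s)^T i j).
  by rewrite mxE; under eq_fun do rewrite mxE; exact: is_derive_coord.
apply: is_derive_eq; first exact: is_derive_mulmx dXG dYT 0 0.
rewrite /inner -/c !covDE -/S -/(G s).
set x := X s c; set y := Y s c; set dx := derive1 _ s; set dy := derive1 _ s.
transitivity (((dx + x *m S) *m G s *m y^T
              + x *m G s *m (dy + y *m S)^T) 0 0); last by rewrite mxE.
congr (fun_of_matrix _ 0 0).
rewrite [(dy + _)^T]linearD /= trmx_mul !(mulmxDl, mulmxDr) !mulmxA -!addrA.
by rewrite (addrC (_ *m S^T *m _)).
Unshelve. all: by end_near. Qed.

End Riemannian.

(** * Concircular fields along curves of prescribed angle *)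

(** This reduces the geometry to the one-variable part above. The field f T
    contributes only to the T-component, the frame being orthonormal. *)
Lemma PA_components (R : realType) (M : topologicalType)
    (A : smooth_atlas R 3 M) (g : riemannian_metric A)
    (o : chart A -> M -> R) (I : set R) (gamma : R -> M)
    (N B : R -> tvec A) (kappa tau : R -> R)
    (V : R -> tvec A) (theta f : R -> R) :
  PA_curve g o I gamma N B kappa tau V theta ->
  concircular_along g gamma I V f ->
  let a s := inner g (gamma s) (V s) (velocity gamma s) in
  let b s := inner g (gamma s) (V s) (N s) in
  let c s := inner g (gamma s) (V s) (B s) in
  [/\ forall s, I s -> is_derive s 1 a (f s + kappa s * b s),
      forall s, I s -> is_derive s 1 b (- kappa s * a s + tau s * c s),
      forall s, I s -> is_derive s 1 c (- tau s * b s) &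
      forall s, I s -> a s ^+ 2 + b s ^+ 2 + c s ^+ 2 = 1].
Proof.
move=> PA [_ covV] a b c; have [smg _ _] := PA_frenet PA.
have smV := PA_smooth PA; have smT := smooth_field_velocity smg.
have fr := PA_apparatus PA.
have smN := frenet_smoothN fr; have smB := frenet_smoothB fr.
have refl s (X : R -> tvec A) : eq_at (gamma s) (X s) (X s) by [].
split=> s Is; have [[tt nn bb] [tn tb nb]] := frenet_orthonormal fr Is.
- apply: (is_derive_eq (is_derive_inner g smg smV smT Is)).
  rewrite (eq_at_inner g (covV s Is) (refl s (velocity gamma))).
  rewrite (eq_at_inner g (refl s V) (frenet_T fr Is)).
  by rewrite inner_scalel tt mulr1 (inner_scaler g _ (kappa s)).
- apply: (is_derive_eq (is_derive_inner g smg smV smN Is)).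
  rewrite (eq_at_inner g (covV s Is) (refl s N)).
  rewrite (eq_at_inner g (refl s V) (frenet_N fr Is)).
  by rewrite inner_scalel tn mulr0 add0r inner_combr.
- apply: (is_derive_eq (is_derive_inner g smg smV smB Is)).
  rewrite (eq_at_inner g (covV s Is) (refl s B)).
  rewrite (eq_at_inner g (refl s V) (frenet_B fr Is)).
  by rewrite inner_scalel tb mulr0 add0r (inner_scaler g _ (- tau s)).
- rewrite -(PA_unit PA Is).
  pose e (i : 'I_3) := nth (velocity gamma s) [:: velocity gamma s; N s; B s] i.
  rewrite (@inner_parseval _ _ _ _ g (gamma s) e).
    by rewrite !big_ord_recl big_ord0 addr0 /= addrA.
  move=> [i Hi] [j Hj]; rewrite /e /=.
  by case: i Hi => [|[|[|]]] //= Hi; case: j Hj => [|[|[|]]] //= Hj;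
    rewrite // inner_sym.
Qed.

Theorem corollary3p13 (R : realType) (M : topologicalType)
    (A : smooth_atlas R 3 M) (g : riemannian_metric A)
    (o : chart A -> M -> R) (I : set R) (gamma : R -> M)
    (N B : R -> tvec A) (kappa tau : R -> R)
    (V : R -> tvec A) (theta f : R -> R) :
  hausdorff_space M -> @second_countable M -> connected [set: M] ->
  is_orientation o ->
  nondegenerate_interval I ->
  PA_curve g o I gamma N B kappa tau V theta ->
  concircular_along g gamma I V f ->
  ~ parallel_along g gamma I V ->
  (forall s, I s -> cos (theta s) != 0) ->
  exists eps : R,
    [/\ eps = 1 \/ eps = -1,
        (* eps is the sign in V = cos theta N + eps sin theta B *)
        forall s, I s -> inner g (gamma s) (V s) (B s) = eps * sin (theta s),
        forall (r0 : R) (F : R -> R), r0 != 0 -> is_antiderivative I f F ->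
          (forall s, I s -> tau s / kappa s = r0) <->
          (exists r1 : R,
             is_inverse_sine I theta (fun s => eps * r0 * F s + r1)) &
        forall r0 f0 : R, r0 != 0 -> f0 != 0 ->
          (forall s, I s -> tau s / kappa s = r0) ->
          (forall s, I s -> f s = f0) ->
          exists s0 sigma : R, (sigma = 1 \/ sigma = -1) /\
            forall s, I s ->
              [/\ - (1 / `|r0 * f0|) < s + s0 < 1 / `|r0 * f0|,
                  kappa s =
                    sigma * (f0 / Num.sqrt (1 - (r0 * f0 * (s + s0)) ^+ 2)) &
                  tau s = r0 * kappa s]].
Proof.
move=> _ _ _ _ ndI PA conc notpar cosN0.
have [da db dc unit] := PA_components PA conc.
have fr := PA_apparatus PA.
have kappa_gt0 := frenet_kappa_gt0 fr; have tau_gt0 := frenet_tau_gt0 fr.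
have bE s : I s -> inner g (gamma s) (V s) (N s) = cos (theta s).
  by move=> Is; rewrite (PA_angle PA).
have bN0 s : I s -> inner g (gamma s) (V s) (N s) != 0.
  by move=> Is; rewrite bE // cosN0.
have smooth_cont u s : smooth_on I u -> I s -> {for s, continuous (u : R -> R)}.
  by move=> smu Is; exact/differentiable_continuous/(smooth_on_differentiable smu).
have cf s : I s -> {for s, continuous f} by exact: smooth_cont conc.1.
have ckappa s : I s -> {for s, continuous kappa}.
  exact: smooth_cont (frenet_smooth_kappa fr).
have fN0 : exists2 s, I s & f s != 0.
  apply: contra_notP notpar => f0 s Is c cs; rewrite (conc.2 s Is c cs) /tscale.
  have [->|fs] := eqVneq (f s) 0; first exact: scale0r.
  by case: f0; exists s.
have a0 := tangential_eq0 ndI da db dc unit kappa_gt0 bN0 cf ckappa fN0.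
have fE := potentialE ndI da db dc unit kappa_gt0 bN0 cf ckappa fN0.
have dtheta s : I s -> derivable theta s 1.
  by move=> Is; apply/derivable1_diffP/(smooth_on_differentiable (PA_smooth_angle PA)).
have [|||eps [epsE cE]] :=
    binormal_sign ndI dc tau_gt0 bN0 (u := sin \o theta).
- move=> s Is; have dth := derivableP (dtheta s Is).
  exact: (@ex_derive _ _ _ _ _ _ _ (is_derive1_comp (is_derive_sin _) dth)).
- by move=> s Is; rewrite sin_ge0_pi // (PA_angle_range PA).
- move=> s Is; rewrite /= sin2cos2 -(unit s Is) a0 // -bE //; ring.
have eps2 : eps * eps = 1 by case: epsE => ->; rewrite ?mulrNN mulr1.
have cosC s : I s -> {for s, continuous (cos \o theta)}.
  move=> Is; apply: continuous_comp; last exact: continuous_cos.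
  exact: smooth_cont (PA_smooth_angle PA) Is.
exists eps; split=> // [r0 F r0N dF|r0 f0].
  have ratioP := ratio_constantP ndI dc kappa_gt0 bN0 fE r0 dF.
  have sineP x := is_inverse_sineP x ndI (PA_angle_range PA) cosN0 cosC.
  (* multiplying by eps, its own inverse, exchanges c and sin theta *)
  split=> [/ratioP[r Hr]|[r /sineP Hr]].
    exists (eps * r); apply/sineP => s Is.
    by rewrite -mulrA -mulrDr -Hr // cE // mulrA eps2 mul1r.
  apply/ratioP; exists (eps * r) => s Is.
  by rewrite cE //= Hr // mulrDr !mulrA eps2 mul1r.
exact: curvature_of_constant_potential.
Qed.
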